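(* In any expanding Robertson-Walker spacetime, the astrometric relative velocity, with respect to the central observer $\beta(\tau)=(\tau,0)$, of a radially receding test particle is always less than the central observer's local speed of light: if the particle satisfies $\frac{d\delta}{d\tau}>0$ at a point with optical coordinates $(\tau,\delta)$, then $\|v_{\mathrm{ast}}\|=\frac{d\delta}{d\tau}<1$ there.
   Context: Units are such that $c=1$. For radial motion it suffices to work in the two-dimensional spacetime with coordinates $(t,\chi)$, $t>0$, and metric $ds^2=-dt^2+a^2(t)\,d\chi^2$. ''Expanding'' means that the scale factor $a$ is a positive, increasing, smooth function of $t>0$. The central observer is $\beta(\tau)=(\tau,0)$, parameterized by its proper time, with 4-velocity $u=\partial/\partial t$. A radially moving test particle is a future-directed timelike curve $\beta'$ parameterized by proper time and located at $\chi>0$. Optical coordinates: an event $q_\ell=(t_\ell,\chi_\ell)$, $\chi_\ell>0$, has optical coordinates $(\tau,\delta)$ with respect to $\beta$, where $p=(\tau,0)$ is the event of $\beta$ such that $q_\ell$ lies on the past-directed null geodesic issuing from $p$, i.e. $\int_{t_\ell}^{\tau}\frac{d\bar\tau}{a(\bar\tau)}=\chi_\ell$, and $\delta$ is the affine distance from $p$ to $q_\ell$, defined as the norm of the projection of $\exp_p^{-1}(q_\ell)$ onto $u^\perp$; explicitly $\delta=\int_{t_\ell}^{\tau}\frac{a(\bar\tau)}{a(\tau)}\,d\bar\tau$. If the test particle has 4-velocity $\dot\tau\,\partial/\partial\tau+\dot\delta\,\partial/\partial\delta$ at $q_\ell$ in optical coordinates, its astrometric relative velocity with respect to $\beta$ at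 $p$ is $v_{\mathrm{ast}}=\frac{d\delta}{d\tau}\mathcal S_p=\frac{\dot\delta}{\dot\tau}\mathcal S_p$, where $\mathcal S_p=\frac{1}{a(\tau)}\frac{\partial}{\partial\chi}\big|_p$ is a unit vector. The particle is radially receding when $d\delta/d\tau>0$. *)

(* Defs.v *)
From Stdlib Require Import Reals.
From Coquelicot Require Import Coquelicot.
Open Scope R_scope.

Definition expanding (a : R -> R) : Prop :=
  (forall t, 0 < t -> 0 < a t) /\
  (forall t1 t2, 0 < t1 -> t1 < t2 -> a t1 < a t2) /\
  (forall (n : nat) t, 0 < t -> ex_derive_n a n t).

(** Events are coordinate pairs [(t, chi)], with [0 < t] required wherever an
    event is used; tangent vectors are given by their components in the basis
    [d/dt, d/dchi]. *)
Definition event : Type := (R * R)%type.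
Definition tvec : Type := (R * R)%type.

Definition in_spacetime (p : event) : Prop := 0 < fst p.

Definition vscale (c : R) (v : tvec) : tvec := (c * fst v, c * snd v).
Definition vadd (v w : tvec) : tvec := (fst v + fst w, snd v + snd w).

Definition metric (a : R -> R) (p : event) (v w : tvec) : R :=
  - (fst v * fst w) + (a (fst p)) ^ 2 * (snd v * snd w).

Definition vnorm (a : R -> R) (p : event) (v : tvec) : R :=
  sqrt (Rabs (metric a p v v)).

Definition null_vector (a : R -> R) (p : event) (v : tvec) : Prop :=
  v <> (0, 0) /\ metric a p v v = 0.

Definition future_directed (v : tvec) : Prop := 0 < fst v.
Definition past_directed (v : tvec) : Prop := fst v < 0.

Definition curve_t (g : R -> event) (s : R) : R := fst (g s).
Definition curve_chi (g : R -> event) (s : R) : R := snd (g s).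

Definition differentiable_at (g : R -> event) (s : R) : Prop :=
  ex_derive (curve_t g) s /\ ex_derive (curve_chi g) s.

Definition velocity (g : R -> event) (s : R) : tvec :=
  (Derive (curve_t g) s, Derive (curve_chi g) s).

(** Affinely parameterized geodesics on [(l, r)].  The nonzero Christoffel
    symbols of [-dt^2 + a(t)^2 dchi^2] are [Gamma^t_(chi chi) = a a'] and
    [Gamma^chi_(t chi) = Gamma^chi_(chi t) = a' / a]. *)
Definition geodesic_on (a : R -> R) (l r : R) (g : R -> event) : Prop :=
  forall s, l < s < r ->
    in_spacetime (g s) /\
    differentiable_at g s /\
    is_derive (Derive (curve_t g)) s
      (- (a (curve_t g s) * Derive a (curve_t g s)
          * (Derive (curve_chi g) s) ^ 2)) /\
    is_derive (Derive (curve_chi g)) s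
      (- (2 * (Derive a (curve_t g s) / a (curve_t g s))
          * Derive (curve_t g) s * Derive (curve_chi g) s)).

(** [is_exp a p v q]: the vector [v] at [p] is in the domain of the exponential
    map and [exp_p v = q]. *)
Definition is_exp (a : R -> R) (p : event) (v : tvec) (q : event) : Prop :=
  exists (g : R -> event) (e : R),
    0 < e /\ geodesic_on a (- e) (1 + e) g /\
    g 0 = p /\ velocity g 0 = v /\ g 1 = q.

Definition central_observer (tau : R) : event := (tau, 0).

Definition u : tvec := (1, 0).

(** Orthogonal projection onto [u^perp]; the sign is [+] because
    [metric a p u u = -1]. *)
Definition proj_u_perp (a : R -> R) (p : event) (v : tvec) : tvec :=
  vadd v (vscale (metric a p v u) u).

Definition radial_test_particle (a : R -> R) (s1 s2 : Rbar) (b : R -> event)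
  : Prop :=
  forall s : R, Rbar_lt s1 s -> Rbar_lt s s2 ->
    in_spacetime (b s) /\ 0 < snd (b s) /\
    differentiable_at b s /\
    metric a (b s) (velocity b s) (velocity b s) = -1 /\
    future_directed (velocity b s).

(** [q], with [chi > 0], has optical coordinates [(tau, delta)] with respect to
    the central observer.  The vector [v] is [exp_p^{-1} q]: by
    [is_exp a p v q] and the conditions on [v], the event [q] lies on the
    past-directed null geodesic issuing from [p]. *)
Definition optical_coordinates (a : R -> R) (q : event) (tau delta : R)
  : Prop :=
  let p := central_observer tau in
  in_spacetime p /\ in_spacetime q /\ 0 < snd q /\
  exists v : tvec,
    null_vector a p v /\ past_directed v /\ is_exp a p v q /\
    delta = vnorm a p (proj_u_perp a p v).

(** [tau] and [delta] are the optical coordinates of a particle as functions of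
    its proper time, so its 4-velocity at proper time [s] is
    [Derive tau s d/dtau + Derive delta s d/ddelta]. *)
Definition ddelta_dtau (tau delta : R -> R) (s : R) : R :=
  Derive delta s / Derive tau s.

Definition S_dir (a : R -> R) (p : event) : tvec := (0, 1 / a (fst p)).

Definition v_ast (a : R -> R) (tau delta : R -> R) (s : R) : tvec :=
  vscale (ddelta_dtau tau delta s) (S_dir a (central_observer (tau s))).

(* Main.v *)
(** Let [A] and [B] be antiderivatives of [a] and [1/a].  Along a null geodesic
    issuing from [(tau, 0)] the quantities [a t'] and [a^2 chi'] are conserved,
    so integrating up to an event [(t, chi)] gives
    [B tau - B t = chi] and [A tau - A t = a tau * delta].  Differentiating both
    identities along the particle, with a dot for the proper-time derivative,
      [ddelta/dtau = 1 - delta * a' tau / a tau - (a t / a tau) * (dot t / dot tau)],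
    where [dot tau = a tau * (dot chi + dot t / a t)] is positive because the
    particle is timelike and future directed.  The two subtracted terms are
    respectively nonnegative and positive. *)

Require Import Defs.
From Stdlib Require Import Reals Lra.
From Coquelicot Require Import Coquelicot.
Open Scope R_scope.

(** * Calculus: slopes, derivatives through an inverse, monotone functions *)

Lemma is_derive_slope (f : R -> R) (x l : R) :
  is_derive f x l ->
  exists phi : R -> R, continuous phi x /\ phi x = l /\
    forall y, f y - f x = phi y * (y - x).
Proof.
intros Hf.
(* Carathéodory's form of differentiability: the difference quotient, completed by [l] at [x]. *)
exists (fun y => if Req_EM_T y x then l else (f y - f x) / (y - x)).
split; [|split].
- apply is_derive_Reals in Hf.
  unfold continuous; destruct (Req_EM_T x x) as [_|n]; [|now elim n].
  apply filterlim_locally; intros eps.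
  destruct (Hf eps (cond_pos eps)) as [d Hd].
  exists d; change (forall y : R, Rabs (y - x) < d -> ball l eps
    (if Req_EM_T y x then l else (f y - f x) / (y - x))).
  intros y Hy.
  destruct (Req_EM_T y x) as [_|n].
  + apply ball_center.
  + specialize (Hd (y - x)).
    replace (x + (y - x)) with y in Hd by ring.
    apply Hd; [lra|exact Hy].
- destruct (Req_EM_T x x) as [_|n]; [reflexivity|now elim n].
- intros y; destruct (Req_EM_T y x) as [->|n]; [ring|field; lra].
Qed.

Lemma slope_is_derive (f phi : R -> R) (x : R) :
  continuous phi x ->
  locally x (fun y => f y - f x = phi y * (y - x)) ->
  is_derive f x (phi x).
Proof.
intros Hphi [d1 H1].
apply is_derive_Reals; intros eps Heps.
destruct (proj1 (filterlim_locally phi (phi x)) Hphi (mkposreal _ Heps))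
  as [d2 H2].
assert (Hd : 0 < Rmin d1 d2) by (apply Rmin_pos; apply cond_pos).
exists (mkposreal _ Hd); simpl; intros h Hh Hlt.
assert (Hb : Rabs (x + h - x) < Rmin d1 d2) by
  (replace (x + h - x) with h by ring; exact Hlt).
rewrite (H1 (x + h)).
- replace (phi (x + h) * (x + h - x) / h) with (phi (x + h)) by (field; lra).
  apply (H2 (x + h)).
  apply Rlt_le_trans with (1 := Hb), Rmin_r.
- apply Rlt_le_trans with (1 := Hb), Rmin_l.
Qed.

(** With Carathéodory slopes [phi] of [F] and [psi] of the composite, [phi (y r) * (y r - y s) = psi
    r * (r - s)], so [psi r / phi (y r)] is a continuous slope for [y]. It serves to differentiate
    [tau], which is known only through [B (tau r)]. *)
Lemma is_derive_comp_inv (F y : R -> R) (s d l : R) :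
  continuous y s -> d <> 0 ->
  is_derive F (y s) d -> is_derive (fun r => F (y r)) s l ->
  is_derive y s (l / d).
Proof.
intros Hy Hd HF HFy.
destruct (is_derive_slope _ _ _ HF) as [phi [Cphi [Ephi Sphi]]].
destruct (is_derive_slope _ _ _ HFy) as [psi [Cpsi [Epsi Spsi]]].
assert (Cphiy : continuous (fun r => phi (y r)) s)
  by (apply continuous_comp; assumption).
rewrite <- Epsi, <- Ephi.
apply (slope_is_derive y (fun r => psi r / phi (y r)) s).
- apply (continuous_mult psi (fun r => / phi (y r))); [exact Cpsi|].
  apply continuous_comp; [exact Cphiy|].
  apply continuity_pt_filterlim, continuity_pt_inv; [apply continuity_pt_id|].
  unfold id; now rewrite Ephi.
- assert (Hnz : locally s (fun r => phi (y r) <> 0)).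
  { apply (Cphiy (fun z => z <> 0)).
    apply (open_neq 0); now rewrite Ephi. }
  revert Hnz; apply filter_imp; intros r Hr.
  apply Rmult_eq_reg_l with (phi (y r)); [|exact Hr].
  rewrite <- Sphi, Spsi; field; exact Hr.
Qed.

(** When [F (y r)] lies between [F (y s - e)] and [F (y s + e)], monotonicity traps [y r] within [e]
    of [y s]. *)
Lemma increasing_comp_continuous (F y : R -> R) (s : R) :
  (forall u v, 0 < u -> u < v -> F u < F v) ->
  locally s (fun r => 0 < y r) ->
  continuous (fun r => F (y r)) s ->
  continuous y s.
Proof.
intros HF Hpos Hc.
assert (Hys : 0 < y s) by (apply locally_singleton with (1 := Hpos)).
apply filterlim_locally; intros eps.
(* The bound [y s / 2] keeps [y s - e] positive, where [F] is monotone. *)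
set (e := Rmin eps (y s / 2)).
assert (He : 0 < e) by (apply Rmin_pos; [apply cond_pos|lra]).
assert (He1 : e <= eps) by apply Rmin_l.
assert (He2 : e <= y s / 2) by apply Rmin_r.
assert (Hl : locally s (fun r => F (y s - e) < F (y r))).
{ apply (Hc (fun z => F (y s - e) < z)), (open_gt (F (y s - e))).
  apply HF; lra. }
assert (Hr : locally s (fun r => F (y r) < F (y s + e))).
{ apply (Hc (fun z => z < F (y s + e))), (open_lt (F (y s + e))).
  apply HF; lra. }
generalize (filter_and _ _ Hpos (filter_and _ _ Hl Hr)).
apply filter_imp; intros r [Hp [H1 H2]].
apply Rabs_def1; unfold minus, plus, opp; simpl.
- destruct (Rlt_le_dec (y r) (y s + e)) as [h|[h|h]]; [lra| |].
  + specialize (HF (y s + e) (y r)); lra.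
  + rewrite <- h in H2; lra.
- destruct (Rlt_le_dec (y s - e) (y r)) as [h|[h|h]]; [lra| |].
  + specialize (HF (y r) (y s - e)); lra.
  + rewrite h in H1; lra.
Qed.

Lemma pos_derive_increasing (F f : R -> R) :
  (forall x, 0 < x -> is_derive F x (f x)) -> (forall x, 0 < x -> 0 < f x) ->
  forall u v, 0 < u -> u < v -> F u < F v.
Proof.
intros HF Hf u v Hu Huv.
apply (incr_function_le F u v f); simpl; try lra.
- intros x Hx _; apply HF; lra.
- intros x Hx _; apply Hf; lra.
Qed.

Lemma increasing_Derive_nonneg (f : R -> R) (x : R) :
  ex_derive f x -> (forall y, x < y -> f x < f y) -> 0 <= Derive f x.
Proof.
intros Hf Hincr.
apply Derive_correct, is_derive_Reals in Hf.
apply Rnot_lt_le; intros Hneg.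
(* This tolerance forces nearby difference quotients below 0, whereas the one with step [d / 2] is
   positive. *)
destruct (Hf (- Derive f x)) as [d Hd]; [lra|].
assert (Hd0 := cond_pos d).
specialize (Hd (d / 2)).
rewrite (Rabs_pos_eq (d / 2)) in Hd by lra.
specialize (Hd ltac:(lra) ltac:(lra)).
apply Rabs_def2 in Hd.
assert (0 < (f (x + d / 2) - f x) / (d / 2)); [|lra].
apply Rdiv_lt_0_compat; [|lra].
specialize (Hincr (x + d / 2)); lra.
Qed.

Lemma antiderivative_pos (f : R -> R) :
  (forall x, 0 < x -> continuous f x) ->
  exists F : R -> R, forall x, 0 < x -> is_derive F x (f x).
Proof.
intros Hf; exists (RInt f 1); intros x Hx.
apply is_derive_RInt with (a := 1); [|now apply Hf].
apply (filter_imp (fun y => 0 < y)); [|now apply (open_gt 0)].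
intros y Hy; apply (RInt_correct f), (ex_RInt_continuous f).
intros z Hz; apply Hf.
apply Rlt_le_trans with (2 := proj1 Hz), Rmin_pos; lra.
Qed.

(** * The scale factor and the antiderivatives [A] of [a] and [B] of [1/a] *)

Section Spacetime.

Variables (a A B : R -> R).
Hypothesis Ha : expanding a.
Hypothesis HA : forall x, 0 < x -> is_derive A x (a x).
Hypothesis HB : forall x, 0 < x -> is_derive B x (/ a x).

Lemma scale_pos x : 0 < x -> 0 < a x.
Proof. apply Ha. Qed.

Lemma scale_ex_derive x : 0 < x -> ex_derive a x.
Proof. intros Hx; exact (proj2 (proj2 Ha) 1%nat x Hx). Qed.

Lemma A_increasing u v : 0 < u -> u < v -> A u < A v.
Proof. apply (pos_derive_increasing A a); [exact HA|exact scale_pos]. Qed.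

Lemma B_increasing u v : 0 < u -> u < v -> B u < B v.
Proof.
apply (pos_derive_increasing B (fun x => / a x)); [exact HB|].
intros x Hx; now apply Rinv_0_lt_compat, scale_pos.
Qed.

(** * First integrals of geodesics, general and null *)

Section Geodesic.

Variables (e : R) (g : R -> event).
Hypothesis He : 0 < e.
Hypothesis Hg : geodesic_on a (- e) (1 + e) g.

Let t := curve_t g.
Let chi := curve_chi g.

Lemma geodesic_t_pos s : 0 <= s <= 1 -> 0 < t s.
Proof. intros Hs; apply Hg; lra. Qed.

Lemma geodesic_t_derive s : 0 <= s <= 1 -> is_derive t s (Derive t s).
Proof.
intros Hs; apply Derive_correct.
destruct (Hg s) as [_ [[H _] _]]; [lra|exact H].
Qed.

Lemma geodesic_chi_derive s : 0 <= s <= 1 -> is_derive chi s (Derive chi s).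
Proof.
intros Hs; apply Derive_correct.
destruct (Hg s) as [_ [[_ H] _]]; [lra|exact H].
Qed.

Lemma geodesic_a_derive s : 0 <= s <= 1 ->
  is_derive (fun s => a (t s)) s (Derive t s * Derive a (t s)).
Proof.
intros Hs; apply (is_derive_comp a t).
- now apply Derive_correct, scale_ex_derive, geodesic_t_pos.
- now apply geodesic_t_derive.
Qed.

(** Conservation law of the Killing field [d/dchi]: the metric does not depend on [chi]. *)
Lemma geodesic_momentum_const s : 0 < s <= 1 ->
  a (t s) ^ 2 * Derive chi s = a (t 0) ^ 2 * Derive chi 0.
Proof.
intros Hs; symmetry.
apply (eq_is_derive (fun s => a (t s) ^ 2 * Derive chi s)); [|lra].
intros r Hr.
destruct (Hg r) as [_ [_ [_ H]]]; [lra|].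
assert (Hr' : 0 <= r <= 1) by lra.
assert (Hp := scale_pos _ (geodesic_t_pos r Hr')).
evar_last.
- apply (is_derive_mult (fun s => a (t s) ^ 2) (Derive chi));
    [apply is_derive_pow, geodesic_a_derive, Hr'|exact H|apply Rmult_comm].
- unfold plus, mult, zero; simpl; fold t chi; field; lra.
Qed.

(** A geodesic transports its own velocity parallelly, so the metric square of the velocity is
    constant; hence nullness at 0 persists. *)
Lemma geodesic_norm_const s : 0 < s <= 1 ->
  (a (t s) * Derive chi s) ^ 2 - Derive t s ^ 2
  = (a (t 0) * Derive chi 0) ^ 2 - Derive t 0 ^ 2.
Proof.
intros Hs; symmetry.
apply (eq_is_derive (fun s => (a (t s) * Derive chi s) ^ 2 - Derive t s ^ 2));
  [|lra].
intros r Hr.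
destruct (Hg r) as [_ [_ [H1 H2]]]; [lra|].
assert (Hr' : 0 <= r <= 1) by lra.
assert (Hp := scale_pos _ (geodesic_t_pos r Hr')).
evar_last.
- apply (is_derive_minus (fun s => (a (t s) * Derive chi s) ^ 2)
                         (fun s => Derive t s ^ 2)).
  + apply is_derive_pow, (is_derive_mult (fun s => a (t s)) (Derive chi));
      [apply geodesic_a_derive, Hr'|exact H2|apply Rmult_comm].
  + apply is_derive_pow; exact H1.
- unfold minus, opp, plus, mult, zero; simpl; fold t chi; field; lra.
Qed.

Hypothesis Hnull : (a (t 0) * Derive chi 0) ^ 2 = Derive t 0 ^ 2.

(** The derivative of [a t'] is [a' * (t'^2 - (a chi')^2)], which vanishes on null geodesics. The
    field [a d/dt] behind this is only conformal Killing. *)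
Lemma null_geodesic_energy_const s : 0 < s <= 1 ->
  a (t s) * Derive t s = a (t 0) * Derive t 0.
Proof.
intros Hs; symmetry.
apply (eq_is_derive (fun s => a (t s) * Derive t s)); [|lra].
intros r Hr.
destruct (Hg r) as [_ [_ [H _]]]; [lra|].
assert (Hr' : 0 <= r <= 1) by lra.
assert (Hn : (a (t r) * Derive chi r) ^ 2 = Derive t r ^ 2).
{ destruct (Req_dec r 0) as [->|n]; [exact Hnull|].
  assert (Hc := geodesic_norm_const r); lra. }
evar_last.
- apply (is_derive_mult (fun s => a (t s)) (Derive t));
    [apply geodesic_a_derive, Hr'|exact H|apply Rmult_comm].
- unfold plus, mult, zero; simpl; fold t chi.
  transitivity (Derive a (t r)
    * (Derive t r ^ 2 - (a (t r) * Derive chi r) ^ 2)); [ring|].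
  rewrite Hn; ring.
Qed.

Lemma null_geodesic_A : A (t 1) - A (t 0) = a (t 0) * Derive t 0.
Proof.
set (W := a (t 0) * Derive t 0).
(* [A (t s)] has derivative [a t' = W], so [A (t s) - W * s] is constant. *)
assert (H : A (t 0) - W * 0 = A (t 1) - W * 1); [|lra].
apply (eq_is_derive (fun s => A (t s) - W * s)); [|lra].
intros r Hr.
assert (HW : a (t r) * Derive t r = W).
{ destruct (Req_dec r 0) as [->|n]; [reflexivity|].
  apply null_geodesic_energy_const; lra. }
evar_last.
- apply (is_derive_minus (fun s => A (t s)) (fun s => W * s)).
  + apply (is_derive_comp A t);
      [now apply HA, geodesic_t_pos|now apply geodesic_t_derive].
  + apply (is_derive_scal (fun s => s)), is_derive_id.
- unfold minus, opp, plus, scal, mult, zero, one; simpl; unfold mult; simpl.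
  lra.
Qed.

Lemma null_geodesic_B : Derive t 0 <> 0 ->
  chi 1 - chi 0 = a (t 0) * Derive chi 0 / Derive t 0 * (B (t 1) - B (t 0)).
Proof.
intros Ht0.
assert (H0 : 0 <= 0 <= 1) by lra.
assert (Hp0 := scale_pos _ (geodesic_t_pos 0 H0)).
(* The two conservation laws give [chi' / t' = c / a] along the curve, so [chi - c * B t] is
   constant. Nullness makes [c] equal to 1 or -1. *)
set (c := a (t 0) * Derive chi 0 / Derive t 0).
assert (H : chi 0 - c * B (t 0) = chi 1 - c * B (t 1)); [|lra].
apply (eq_is_derive (fun s => chi s - c * B (t s))); [|lra].
intros r Hr.
assert (Hp := scale_pos _ (geodesic_t_pos r Hr)).
assert (HW : Derive t r = a (t 0) * Derive t 0 / a (t r)).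
{ apply Rmult_eq_reg_l with (a (t r)); [|lra].
  transitivity (a (t 0) * Derive t 0); [|field; lra].
  destruct (Req_dec r 0) as [->|n]; [reflexivity|].
  apply null_geodesic_energy_const; lra. }
assert (HK : Derive chi r = a (t 0) ^ 2 * Derive chi 0 / a (t r) ^ 2).
{ apply Rmult_eq_reg_l with (a (t r) ^ 2); [|nra].
  transitivity (a (t 0) ^ 2 * Derive chi 0); [|field; lra].
  destruct (Req_dec r 0) as [->|n]; [reflexivity|].
  apply geodesic_momentum_const; lra. }
evar_last.
- apply (is_derive_minus chi (fun s => c * B (t s))).
  + now apply geodesic_chi_derive.
  + apply (is_derive_scal (fun s => B (t s))), (is_derive_comp B t);
      [now apply HB, geodesic_t_pos|now apply geodesic_t_derive].
- unfold minus, opp, plus, scal, mult, zero; simpl; unfold mult; simpl.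
  rewrite HK, HW; unfold c; field; lra.
Qed.

End Geodesic.

(** * Optical coordinates in integral form *)

Lemma optical_coordinates_integrals q tau delta :
  optical_coordinates a q tau delta ->
  0 < tau /\ 0 < delta /\
  B tau - B (fst q) = snd q /\ A tau - A (fst q) = a tau * delta.
Proof.
intros [Htau [Hq [Hchi [v [[_ Hn] [Hpast [Hexp Hdelta]]]]]]].
destruct Hexp as [g [e [He [Hg [g0 [Hv g1]]]]]].
destruct v as [v0 v1]; unfold velocity in Hv; injection Hv as Hv0 Hv1.
unfold metric, central_observer, past_directed, in_spacetime in *.
unfold vnorm, proj_u_perp, metric, vadd, vscale, u in Hdelta.
simpl in *.
assert (Hat := scale_pos tau Htau).
assert (Hnull : (a tau * v1) ^ 2 = v0 ^ 2) by lra.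
(* The projection is [(0, v1)], of norm [a tau * |v1| = |v0|] by nullness, and [v0 < 0] because [v]
   is past directed. *)
assert (Hd : delta = - v0).
{ rewrite Hdelta, <- (sqrt_pow2 (- v0)) by lra.
  apply f_equal.
  match goal with |- Rabs ?x = _ => replace x with ((- v0) ^ 2) by nra end.
  apply Rabs_pos_eq, pow2_ge_0. }
assert (T0 : curve_t g 0 = tau) by (unfold curve_t; now rewrite g0).
assert (C0 : curve_chi g 0 = 0) by (unfold curve_chi; now rewrite g0).
assert (T1 : curve_t g 1 = fst q) by (unfold curve_t; now rewrite g1).
assert (C1 : curve_chi g 1 = snd q) by (unfold curve_chi; now rewrite g1).
assert (N : (a (curve_t g 0) * Derive (curve_chi g) 0) ^ 2
            = Derive (curve_t g) 0 ^ 2) by now rewrite T0, Hv0, Hv1.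
assert (EA := null_geodesic_A e g He Hg N).
assert (EB := null_geodesic_B e g He Hg N).
rewrite T0, T1, Hv0 in EA.
rewrite T0, T1, C0, C1, Hv0, Hv1 in EB.
specialize (EB ltac:(lra)).
(* [EA] makes [A (fst q) - A tau] negative, and [A] is increasing. *)
assert (Hlt : fst q < tau).
{ destruct (Rlt_le_dec (fst q) tau) as [h|[h|h]]; [exact h| |].
  - assert (A tau < A (fst q)) by now apply A_increasing.
    nra.
  - rewrite <- h in EA; nra. }
assert (HBlt := B_increasing _ _ Hq Hlt).
(* Nullness leaves two signs; the other one would give [snd q = B (fst q) - B tau < 0]. *)
assert (Hsign : a tau * v1 = - v0).
{ destruct (Rsqr_eq (a tau * v1) v0) as [h|h]; [unfold Rsqr; lra| |exact h].
  exfalso; rewrite h in EB.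
  replace (v0 / v0) with 1 in EB by (field; lra); lra. }
rewrite Hsign in EB.
replace (- v0 / v0) with (-1) in EB by (field; lra).
repeat split; lra || (rewrite Hd; lra).
Qed.

(** * Differentiation along the particle and the bound *)

(** The normalization factors as [(t' + alpha chi') * (t' - alpha chi') = 1], and the two factors
    have the positive sum [2 t']. *)
Lemma timelike_future_null_component (alpha t' chi' : R) :
  0 < alpha -> 0 < t' -> - (t' * t') + alpha ^ 2 * (chi' * chi') = -1 ->
  0 < chi' + t' / alpha.
Proof.
intros Halpha Ht Hm.
assert (0 < t' + alpha * chi') by nra.
replace (chi' + t' / alpha) with ((t' + alpha * chi') / alpha) by (field; lra).
now apply Rdiv_lt_0_compat.
Qed.

(** Differentiability of [tau] and [delta] is extracted from the integral identities near [s]: first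
    for [B (tau r)], then for [tau], then for [a (tau r) * delta r], and finally for [delta]. *)
Lemma ddelta_dtau_lt_1 (b : R -> event) (tau delta : R -> R) (s : R) :
  in_spacetime (b s) -> differentiable_at b s ->
  metric a (b s) (velocity b s) (velocity b s) = -1 ->
  future_directed (velocity b s) ->
  locally s (fun r => optical_coordinates a (b r) (tau r) (delta r)) ->
  ddelta_dtau tau delta s < 1.
Proof.
intros Hb [Dt Dchi] Hm Hf Hopt.
unfold metric, velocity, future_directed, in_spacetime in *; simpl in *.
apply (filter_imp _ _ (fun r =>
  optical_coordinates_integrals (b r) (tau r) (delta r))) in Hopt.
destruct (locally_singleton _ _ Hopt) as [Htau [Hdelta _]].
assert (Hat := scale_pos _ Htau).
assert (Hab := scale_pos _ Hb).
apply Derive_correct in Dt; apply Derive_correct in Dchi.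
set (t' := Derive (curve_t b) s) in *.
set (chi' := Derive (curve_chi b) s) in *.
assert (Hnu := timelike_future_null_component _ _ _ Hab Hf Hm).
set (nu := chi' + t' / a (fst (b s))) in *.
assert (DB : is_derive (fun r => B (tau r)) s nu).
{ apply is_derive_ext_loc with
    (fun r => plus (curve_chi b r) (B (curve_t b r))).
  - revert Hopt; apply filter_imp; intros r [_ [_ [H _]]].
    unfold plus, curve_chi, curve_t; simpl; lra.
  - apply (is_derive_plus (curve_chi b) (fun r => B (curve_t b r)));
      [exact Dchi|].
    apply (is_derive_comp B (curve_t b)); [now apply HB|exact Dt]. }
(* Inverts [B], whose derivative [/ a (tau s)] is nonzero; continuity of [tau] comes from
   monotonicity of [B]. *)
assert (Dtau : is_derive tau s (nu / / a (tau s))).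
{ apply is_derive_comp_inv with B; [| |now apply HB|exact DB].
  - apply (increasing_comp_continuous B); [exact B_increasing| |].
    + revert Hopt; apply filter_imp; intros r [H _]; exact H.
    + apply (ex_derive_continuous (fun r => B (tau r))); now exists nu.
  - apply Rinv_neq_0_compat; lra. }
set (tau' := nu / / a (tau s)) in Dtau.
assert (Htau' : 0 < tau')
  by (apply Rdiv_lt_0_compat; [|apply Rinv_0_lt_compat]; assumption).
clearbody tau'.
assert (Da : is_derive (fun r => a (tau r)) s (tau' * Derive a (tau s))).
{ apply (is_derive_comp a tau); [|exact Dtau].
  now apply Derive_correct, scale_ex_derive. }
assert (DA : is_derive (fun r => a (tau r) * delta r) s
               (tau' * a (tau s) - t' * a (fst (b s)))).
{ apply is_derive_ext_loc with
    (fun r => minus (A (tau r)) (A (curve_t b r))).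
  - revert Hopt; apply filter_imp; intros r [_ [_ [_ H]]]; exact H.
  - apply (is_derive_minus (fun r => A (tau r)) (fun r => A (curve_t b r)));
      [apply (is_derive_comp A tau)|apply (is_derive_comp A (curve_t b))];
      auto. }
assert (Hpos : 0 <= Derive a (tau s)).
{ apply increasing_Derive_nonneg; [now apply scale_ex_derive|].
  intros y Hy; apply Ha; assumption. }
assert (Ddelta : Derive delta s =
  (tau' * a (tau s) - t' * a (fst (b s)) - tau' * Derive a (tau s) * delta s)
  / a (tau s)).
{ apply is_derive_unique.
  apply is_derive_ext_loc with (fun r => (a (tau r) * delta r) / a (tau r)).
  - revert Hopt; apply filter_imp; intros r [H _].
    assert (Hr := scale_pos _ H).
    match goal with |- ?x = ?y => change (@eq R x y) end; field; lra.
  - evar_last.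
    + apply (is_derive_div (fun r => a (tau r) * delta r)
                           (fun r => a (tau r))); [exact DA|exact Da|lra].
    + field; lra. }
unfold ddelta_dtau; rewrite Ddelta, (is_derive_unique _ _ _ Dtau).
(* Once denominators are cleared, the left side is [tau' * a (tau s)] minus one positive and one
   nonnegative term. *)
apply Rmult_lt_reg_r with (tau' * a (tau s)); [now apply Rmult_lt_0_compat|].
match goal with |- ?x < _ => replace x with
  (tau' * a (tau s) - t' * a (fst (b s)) - tau' * Derive a (tau s) * delta s)
end; [|field; lra].
assert (0 < t' * a (fst (b s))) by now apply Rmult_lt_0_compat.
assert (0 <= tau' * Derive a (tau s) * delta s)
  by (repeat apply Rmult_le_pos; lra).
lra.
Qed.

Lemma vnorm_S_dir (c tau : R) : 0 < tau -> 0 <= c ->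
  vnorm a (central_observer tau) (vscale c (S_dir a (central_observer tau))) = c.
Proof.
intros Htau Hc; assert (Hat := scale_pos _ Htau).
unfold vnorm, metric, vscale, S_dir, central_observer; simpl.
match goal with |- sqrt (Rabs ?x) = _ =>
  replace x with (c ^ 2) by (field; lra) end.
rewrite Rabs_pos_eq by apply pow2_ge_0.
now apply sqrt_pow2.
Qed.

End Spacetime.

Theorem proposition2p2 :
  forall (a : R -> R), expanding a ->
  forall (s1 s2 : Rbar) (beta' : R -> event), radial_test_particle a s1 s2 beta' ->
  forall s : R, Rbar_lt s1 s -> Rbar_lt s s2 ->
  forall tau delta : R -> R,
    locally s (fun r => optical_coordinates a (beta' r) (tau r) (delta r)) ->
    0 < ddelta_dtau tau delta s ->
    vnorm a (central_observer (tau s)) (v_ast a tau delta s)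
      = ddelta_dtau tau delta s /\
    ddelta_dtau tau delta s < 1.
Proof.
intros a Ha s1 s2 b Hb s Hs1 Hs2 tau delta Hopt Hpos.
destruct (Hb s Hs1 Hs2) as [Hin [_ [Hdiff [Hm Hf]]]].
assert (Hc : forall x, 0 < x -> continuous a x)
  by (intros x Hx; now apply (ex_derive_continuous a), scale_ex_derive).
(* Smoothness and positivity of [a] make [a] and [1/a] continuous, which provides [A] and [B]. *)
destruct (antiderivative_pos a Hc) as [A HA].
destruct (antiderivative_pos (fun x => / a x)) as [B HB].
{ intros x Hx; apply continuous_comp; [now apply Hc|].
  apply continuity_pt_filterlim, continuity_pt_inv; [apply continuity_pt_id|].
  apply Rgt_not_eq, (scale_pos a Ha x Hx). }
split.
- apply vnorm_S_dir; [exact Ha| |lra].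
  apply (locally_singleton _ _ Hopt).
- now apply (ddelta_dtau_lt_1 a A B Ha HA HB b).
Qed.
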